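(* Let $e,d,r$ be positive integers with $d\mid e$, $e\neq d$ and $r>1$. Then the reflection arrangement $\mathcal{A}_r$ of the complex reflection group $G(e,d,r)$ is combinatorially simplicial.
   Context: For $d\mid e$, $G(e,d,r)\le\mathrm{GL}_r(\mathbb{C})$ is the group of $r\times r$ monomial matrices whose nonzero entries are $e$-th roots of unity with product an $(e/d)$-th root of unity. The reflection arrangement of a finite complex reflection group is the set of its reflecting hyperplanes (fixed hyperplanes of its reflections), here in $\mathbb{C}^r$. An arrangement of hyperplanes is a finite set of hyperplanes in $V=K^r$; it is central if all hyperplanes are linear subspaces, and a central arrangement is essential if the intersection of all its hyperplanes is $0$. The intersection lattice $L(\mathcal{A})$ is the set of all intersections of elements of $\mathcal{A}$ (including $V$ as the empty intersection), ordered by reverse inclusion. The characteristic polynomial is $\chi_{\mathcal{A}}(t)=\sum_{X\in L(\mathcal{A})}\mu(X)t^{\dim X}$, where $\mu(X)=\mu(V,X)$ is the Möbius function of $L(\mathcal{A})$. For $X\in L(\mathcal{A})$ the restriction is $\mathcal{A}^X=\{X\cap H\mid H\in\mathcal{A},\ X\not\subseteq H,\ X\cap H\neq\emptyset\}$, an arrangement in $X$. A finite set $\mathcal{A}$ of hyperplanes in $K^r$ is (combinatorially) simplicial if it is a central, essential arrangement satisfying $r\chi_{\mathcal{A}}(-1)+2\sum_{H\in\mathcal{A}}\chi_{\mathcal{A}^H}(-1)=0$. *)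

(* Defs.v *)
From mathcomp Require Import all_boot all_order all_algebra.
From mathcomp Require Import finmap complex.
From mathcomp Require Import boolp classical_sets cardinality reals.

Set Implicit Arguments.
Unset Strict Implicit.
Unset Printing Implicit Defensive.

Import GRing.Theory.

Local Open Scope ring_scope.

Section Mobius.
Variables (T : choiceType) (le : rel T) (P : {fset T}).

(* mu(x, x) = 1 and mu(x, y) = - \sum_(x <= z < y) mu(x, z), with z in P; n is
   fuel, and #|` P | is enough of it for a partial order (lemma mobius_sum). *)
Fixpoint mobius_rec (n : nat) (x y : T) : int :=
  if n is n'.+1 then
    if x == y then 1
    else if le x y then
      - \sum_(z <- P | [&& le x z, le z y & z != y]) mobius_rec n' x z
    else 0
  else 0.

Definition mobius : T -> T -> int := mobius_rec #|` P |.

Hypotheses (le_refl : reflexive le) (le_anti : antisymmetric le)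
  (le_trans : transitive le).

Let below y := [fset z in P | le z y]%fset.

Let below_lt z y : y \in P -> le z y -> z != y ->
  (#|` below z | < #|` below y |)%N.
Proof.
move=> yP lezy nezy; apply: fproper_ltn_card; rewrite fproperE.
apply/andP; split; apply/fsubsetP.
  by move=> t; rewrite !inE => /andP[-> letz]; apply: le_trans lezy.
move/(_ y); rewrite !inE yP le_refl => /(_ isT) leyz.
by case/eqP: nezy; apply: le_anti; rewrite lezy.
Qed.

Let mobius_rec_fuel n m x y : y \in P ->
  (#|` below y | <= n)%N -> (#|` below y | <= m)%N ->
  mobius_rec n x y = mobius_rec m x y.
Proof.
elim: n m x y => [|n IHn] [|m] x y yP //=.
- rewrite leqn0 cardfs_eq0 => /eqP b0 _.
  have: y \in below y by rewrite !inE yP le_refl.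
  by rewrite b0 inE.
- move=> _; rewrite leqn0 cardfs_eq0 => /eqP b0.
  have: y \in below y by rewrite !inE yP le_refl.
  by rewrite b0 inE.
move=> len lem; case: eqP => // _; case: ifP => // _; congr (- _).
rewrite big_seq_cond [RHS]big_seq_cond; apply: eq_bigr => z.
case/and4P=> zP _ lezy nezy; have ltb := below_lt yP lezy nezy.
by apply: IHn => //; rewrite -ltnS; apply: leq_trans ltb _.
Qed.

Lemma mobiusxx x : x \in P -> mobius x x = 1.
Proof.
move=> xP; rewrite /mobius; have: (0 < #|` P |)%N.
  by rewrite cardfs_gt0; apply/fset0Pn; exists x.
by case: #|` P | => //= n _; rewrite eqxx.
Qed.

Lemma mobius_sum x y : x \in P -> y \in P -> le x y -> x != y ->
  \sum_(z <- P | le x z && le z y) mobius x z = 0.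
Proof.
move=> xP yP lexy nexy.
rewrite big_mkcond (bigD1_seq y) ?fset_uniq //= lexy le_refl /= -big_mkcondr.
have: (#|` below y | <= #|` P |)%N by apply: fsubset_leq_card; apply: fset_sub.
rewrite {1}/mobius; case EP: #|` P | => [|n] /= leb.
  by move/eqP: EP; rewrite cardfs_eq0 => /eqP P0; move: xP; rewrite P0.
rewrite (negPf nexy) lexy; apply/eqP; rewrite addrC subr_eq0; apply/eqP.
rewrite big_seq_cond [RHS]big_seq_cond; apply: eq_big => [z|z].
  by case: (z == y); rewrite ?andbF ?andbT.
case/and4P=> zP nezy _ lezy; have ltb := below_lt yP lezy nezy.
apply: mobius_rec_fuel => //; last by rewrite -ltnS; apply: leq_trans leb.
by apply: fsubset_leq_card; apply: fset_sub.
Qed.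

End Mobius.

Section Arrangement.
Variables (K : fieldType) (vT : vectType K).

(* An arrangement is a set of linear hyperplanes of a subspace V of vT. Since
   its members are linear subspaces, it is central by construction, and all the
   intersections of its members are nonempty. The ambient space V is explicit
   because restrictions are arrangements in a smaller space. *)
Implicit Types (V X H : {vspace vT}) (A : {fset {vspace vT}}).

Definition is_arrangement V A : Prop :=
  forall H, H \in A -> (H <= V)%VS /\ (\dim H).+1 = \dim V.

Definition lattice V A : {fset {vspace vT}} :=
  [fset (V :&: \bigcap_(H <- enum_fset (B : {fset {vspace vT}})) H)%VS
    | B in fpowerset A]%fset.

Definition rev_incl : rel {vspace vT} := fun X Y => (Y <= X)%VS.

Definition char_poly_arr V A : {poly int} :=
  \sum_(X <- lattice V A) mobius rev_incl (lattice V A) V X *: 'X^(\dim X).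

(* The condition that X :&: H is nonempty holds for all linear subspaces. *)
Definition restriction A X : {fset {vspace vT}} :=
  [fset (X :&: H)%VS | H in A & ~~ (X <= H)%VS]%fset.

Definition essential V A : Prop :=
  (V :&: \bigcap_(H <- enum_fset A) H)%VS = 0%VS.

End Arrangement.

Definition combinatorially_simplicial (K : fieldType) (r : nat)
    (A : set {vspace 'cV[K]_r}) : Prop :=
  finite_set A /\
  let A := fset_set A in
  [/\ is_arrangement fullv A,
      essential fullv A &
      r%:Z * (char_poly_arr fullv A).[-1]
      + 2 * (\sum_(H <- A) (char_poly_arr H (restriction A H)).[-1]) = 0].

Section ReflectionGroup.
Variables (K : fieldType) (r : nat).

Definition fix_mx (g : 'M[K]_r) : {vspace 'cV[K]_r} :=
  fixedSpace (linfun (mulmx g)).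

Definition is_reflection (g : 'M[K]_r) : Prop :=
  (exists2 n : nat, (0 < n)%N & g ^+ n = 1%:M) /\ (\dim (fix_mx g)).+1 = r.

Definition reflection_arrangement (G : set 'M[K]_r) : set {vspace 'cV[K]_r} :=
  [set H | exists g, [/\ G g, is_reflection g & H = fix_mx g]]%classic.

Definition monomial_mx (g : 'M[K]_r) : Prop :=
  (forall i, exists! j, g i j != 0) /\ (forall j, exists! i, g i j != 0).

Definition Gedr (e d : nat) : set 'M[K]_r :=
  [set g : 'M[K]_r |
    [/\ monomial_mx g,
        forall i j, g i j != 0 -> g i j ^+ e = 1 &
        (\prod_(ij : 'I_r * 'I_r | g ij.1 ij.2 != 0) g ij.1 ij.2)
          ^+ (e %/ d) = 1]]%classic.

End ReflectionGroup.

Arguments Gedr : clear implicits.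

(* Main.v *)
Require Import Defs.
From HB Require Import structures.
From mathcomp Require Import all_boot all_order all_algebra.
From mathcomp Require Import perm separable cyclotomic.
From mathcomp Require Import finmap complex zify ring.
From mathcomp Require Import boolp classical_sets cardinality reals.

(** The reflecting hyperplanes of G(e,d,r), for d a proper divisor of e, are the
    r coordinate hyperplanes x_i = 0 and the hyperplanes x_i = z x_j with
    i < j and z an e-th root of unity, so r + e r(r-1)/2 of them
    ([reflection_arrangement_Gedr], [card_monomial_arr]). The whole statement
    follows from the two characteristic polynomials

      chi(A_r) = P_r   and   chi(A_r restricted to H) = P_(r-1)  for every H,

    where P_n(t) = (t - 1)(t - 1 - e) ... (t - 1 - (n-1)e): at t = -1,
    P_r = - (2 + (r-1)e) P_(r-1), while twice the number of hyperplanes is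
    r (2 + (r-1)e), and the two terms of the simpliciality equation cancel
    ([monomial_arr_simplicial]).

    The polynomials are found by a finite field method carried out in
    characteristic zero. Let S be a finite set of scalars that contains 0 and is
    stable under multiplication by e-th roots of unity, and let q be its size.
    Any intersection of hyperplanes of A_r is cut out by equations
    x_i = c_i x_(f i), where c_i is 0 or an e-th root of unity and the
    coordinates fixed by f with c_i = 1 are free ([monomial_flat]). Hence a flat
    X contains exactly q^(dim X) points of S^r ([card_flat]). Moebius inversion
    then gives chi(q) as the number of points of S^r on no hyperplane
    ([char_poly_arr_count]), and chi of the restriction to H, at q, as the number
    of points of S^r on H and on no other hyperplane; a restriction needs no
    separate treatment since its flats are flats of A_r.

    A point lies on no hyperplane exactly when 0 and the e-th powers of its
    coordinates are all distinct ([generic]); choosing the coordinates one by one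
    gives P_r(q) such points, as each coordinate forbids e values to the next ones
    ([card_generic]). A point on x_i = z x_j alone is determined by deleting its
    i-th coordinate, which leaves an arbitrary generic point of S^(r-1)
    ([insert_off_hyps]). Since S may be taken of size 1 + N e for every N
    ([sample]), these values determine the polynomials. *)

Set Implicit Arguments.
Unset Strict Implicit.
Unset Printing Implicit Defensive.

Import Order.TTheory GRing.Theory Num.Theory.
Local Open Scope ring_scope.

(** * Evaluating a characteristic polynomial by counting points *)

Section Counting.
Variables (K : fieldType) (vT : vectType K).
Implicit Types (V X H : {vspace vT}) (A : {fset {vspace vT}}).

Lemma memv_bigcap_seq (s : seq {vspace vT}) v :
  (v \in (\bigcap_(H <- s) H)%VS) = all (fun H => v \in H) s.
Proof.
elim: s => [|H s IHs] /=; first by rewrite big_nil memvf.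
by rewrite big_cons memv_cap IHs.
Qed.

Lemma latticeP V A X :
  reflect (exists2 B, (B `<=` A)%fset &
             X = (V :&: \bigcap_(H <- enum_fset B) H)%VS)
          (X \in lattice V A).
Proof.
apply: (iffP (imfsetP _ _ _ _)) => -[B BA ->]; exists B => //.
  by rewrite -fpowersetE.
by rewrite /= fpowersetE.
Qed.

Lemma lattice_subv V A X : X \in lattice V A -> (X <= V)%VS.
Proof. by case/latticeP=> B _ ->; apply: capvSl. Qed.

Lemma rev_incl_refl : reflexive (@rev_incl K vT).
Proof. by move=> X; apply: subvv. Qed.
Lemma rev_incl_anti : antisymmetric (@rev_incl K vT).
Proof. by move=> X Y /andP[XY YX]; apply/subv_anti/andP. Qed.
Lemma rev_incl_trans : transitive (@rev_incl K vT).
Proof. by move=> Y X Z YX ZY; apply: subv_trans ZY YX. Qed.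

(** A point p contributes to chi(q) the sum of mu(X) over the flats X through p.
    These are the flats above the least one, Xp, so that the sum vanishes unless
    Xp = V, that is unless p avoids A. Any finite family of points with
    q^(dim X) members in each flat X will do. *)
Lemma char_poly_arr_count (P : finType) (pt : P -> vT) V A (q : nat) :
  (forall H, H \in A -> ~~ (V <= H)%VS) ->
  (forall X, X \in lattice V A -> #|[set p | pt p \in X]| = (q ^ \dim X)%N) ->
  (char_poly_arr V A).[q%:Z] =
    #|[set p | (pt p \in V) && [forall H : A, pt p \notin val H]]|%:Z.
Proof.
move=> A_proper count_X; rewrite /char_poly_arr horner_sum.
set L := lattice V A; set mu := mobius _ _ _.
have VL : V \in L.
  apply/latticeP; exists fset0; first exact: fsub0set.
  by rewrite big_seq_fset0 capvf.
(* Replace q^(dim X) by the number of points in X and exchange the sums. *)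
transitivity (\sum_(p : P) \sum_(X <- L | pt p \in X) mu X).
  under [RHS]eq_bigr => p _ do rewrite big_mkcond.
  rewrite exchange_big /= !big_seq; apply: eq_bigr => X XL.
  rewrite hornerZ hornerXn -natz -natrX -count_X // -sum1_card natr_sum mulr_sumr.
  rewrite [LHS]big_mkcond; apply: eq_bigr => p _.
  by rewrite inE; case: ifP => //; rewrite mulr1.
rewrite -natz -sum1_card natr_sum [RHS]big_mkcond; apply: eq_bigr => p _.
rewrite inE; case: (boolP (pt p \in V)) => [pV | pNV] /=; last first.
  rewrite big_seq_cond big1 // => X /andP[XL pX].
  by case/negP: pNV; apply: subvP (lattice_subv XL) _ pX.
(* Xp is the intersection of the members of A through p. *)
set B := [fset H in A | pt p \in H]%fset.
set Xp := (V :&: \bigcap_(H <- enum_fset B) H)%VS.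
have XpL : Xp \in L.
  by apply/latticeP; exists B => //; apply: fset_sub.
have pXp : pt p \in Xp.
  by rewrite memv_cap pV memv_bigcap_seq; apply/allP => H; rewrite !inE => /andP[].
have leXp X : X \in L -> (pt p \in X) = (Xp <= X)%VS.
  move=> XL; apply/idP/idP => [|XpX]; last exact: subvP XpX _ pXp.
  case/latticeP: XL => C CA ->; rewrite memv_cap pV memv_bigcap_seq => /allP pC.
  apply/subvP => v; rewrite !memv_cap !memv_bigcap_seq => /andP[-> /allP vB].
  apply/allP => H HC; apply: vB; rewrite !inE pC // andbT.
  exact: (fsubsetP CA).
transitivity (\sum_(X <- L | rev_incl V X && rev_incl X Xp) mu X).
  rewrite big_seq_cond [RHS]big_seq_cond; apply: eq_bigl => X.
  case XL: (X \in L) => //=; rewrite /rev_incl (lattice_subv XL) /=.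
  by rewrite leXp.
case: ifP => [/forallP pA | /negbT].
  have XpV : Xp = V.
    rewrite /Xp (_ : B = fset0) ?big_seq_fset0 ?capvf //.
    apply/fsetP => H; rewrite !inE; apply/negbTE/negP => /andP[HA].
    by apply/negP; apply: (pA [` HA]%fset).
  rewrite XpV -big_filter (_ : [seq _ <- _ | _] = [seq X <- L | X == V]); last first.
    apply: eq_filter => X; apply/andP/eqP => [[VX XV]|->]; last by rewrite rev_incl_refl.
    by apply: rev_incl_anti; rewrite VX XV.
  by rewrite filter_pred1_uniq ?fset_uniq // big_seq1 /mu mobiusxx.
rewrite negb_forall => /existsP[[H HA] /=]; rewrite negbK => pH.
apply: (mobius_sum (@rev_incl_refl) (@rev_incl_anti) (@rev_incl_trans)) => //.
  exact: capvSl.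
apply/eqP => VXp; have/negP := A_proper H HA; apply; rewrite VXp.
apply/subvP => v; rewrite memv_cap memv_bigcap_seq => /andP[_ /allP]; apply.
by rewrite !inE HA.
Qed.

End Counting.

(** * The hyperplanes x_i = z x_j *)

Lemma neq_ord_exists r (i : 'I_r) : (1 < r)%N -> exists j, i != j.
Proof.
move=> r_gt1; pose i0 := Ordinal (ltnW r_gt1); pose i1 := Ordinal r_gt1.
by case: (eqVneq i i0) => [->|ii0]; [exists i1 | exists i0].
Qed.

Lemma unity_root_neq0 (K : fieldType) e (z : K) :
  (0 < e)%N -> z ^+ e = 1 -> z != 0.
Proof.
move=> e_gt0; apply: contra_eq_neq => ->.
by rewrite expr0n gtn_eqF // eq_sym oner_eq0.
Qed.

Section Hyperplanes.
Variables (K : fieldType) (r : nat).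
Implicit Types (X Y : {vspace 'cV[K]_r}) (i j k : 'I_r) (x : 'cV[K]_r).

Definition coord_diff i j (z : K) x : K^o := x i 0 - z * x j 0.

Fact coord_diff_linear i j z : linear (coord_diff i j z).
Proof.
move=> a x y; rewrite /coord_diff !mxE /GRing.scale /=.
by rewrite mulrBr mulrDr opprD addrACA [z * (a * _)]mulrCA.
Qed.

HB.instance Definition _ i j z :=
  GRing.isLinear.Build K 'cV[K]_r K^o _ (coord_diff i j z) (coord_diff_linear i j z).

(** The coordinate hyperplane x_i = 0 is [hyp i j 0], for any j, even j = i; this
    makes one family of all the hyperplanes. For i = j and z != 0, [hyp i j z]
    need not be a hyperplane, whence the side condition of some lemmas. *)
Definition hyp i j z : {vspace 'cV[K]_r} := lker (linfun (coord_diff i j z)).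

Lemma mem_hyp i j z x : (x \in hyp i j z) = (x i 0 == z * x j 0).
Proof. by rewrite memv_ker lfunE /= subr_eq0. Qed.

Lemma dim_cap_hyp X i j z :
  ~~ (X <= hyp i j z)%VS -> (\dim (X :&: hyp i j z)).+1 = \dim X.
Proof.
move=> XNH; rewrite -(limg_ker_dim (linfun (coord_diff i j z)) X) -addn1.
congr (_ + _)%N; apply/esym/eqP; rewrite eqn_leq; apply/andP; split.
  by rewrite (leq_trans (dimvS (subvf _))) // dimvf.
rewrite lt0n dimv_eq0; apply: contra XNH => /eqP fX0.
by rewrite /hyp lkerE fX0.
Qed.

Lemma delta_notin_hyp i j z : i != j \/ z = 0 -> delta_mx i 0 \notin hyp i j z.
Proof.
rewrite mem_hyp !mxE !eqxx /= => -[/negbTE|->]; last by rewrite mul0r oner_eq0.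
by rewrite eq_sym => ->; rewrite mulr0 oner_eq0.
Qed.

Lemma delta_in_hyp i j k z : k != i -> k != j -> delta_mx k 0 \in hyp i j z.
Proof.
by rewrite mem_hyp !mxE !(eq_sym k) => /negbTE-> /negbTE->; rewrite mulr0.
Qed.

Lemma dim_hyp i j z : i != j \/ z = 0 -> (\dim (hyp i j z)).+1 = r.
Proof.
move=> ij; have := @dim_cap_hyp fullv i j z; rewrite capfv dimvf dim_matrix mulr1; apply.
by apply/negP => /subvP/(_ _ (memvf (delta_mx i 0))); apply/negP/delta_notin_hyp.
Qed.

Lemma hyp0 i j k : hyp i j 0 = hyp i k 0.
Proof. by apply/vspaceP => x; rewrite !mem_hyp !mul0r. Qed.

Lemma hypV i j z : z != 0 -> hyp i j z = hyp j i z^-1.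
Proof.
move=> z0; apply/vspaceP => x; rewrite !mem_hyp [RHS]eq_sym.
by rewrite (can2_eq (mulVKf z0) (mulKf z0)).
Qed.

End Hyperplanes.

(** * The intersections of such hyperplanes *)

Section Flats.
Variables (K : fieldType) (r e : nat).
Implicit Types (X Y : {vspace 'cV[K]_r}) (i j k : 'I_r) (x : 'cV[K]_r).

Definition zero_or_root (z : K) : bool := (z == 0) || (z ^+ e == 1).

Definition free_coords (f : 'I_r -> 'I_r) (c : 'I_r -> K) : {set 'I_r} :=
  [set i | (f i == i) && (c i == 1)].

(** X is the image of x |-> (c_i x_(f i)), a projection by the first two
    conditions; it is parametrized by the coordinates in [free_coords]. *)
Record monomial_flat X (f : 'I_r -> 'I_r) (c : 'I_r -> K) : Prop := MonomialFlat {
  flat_f_idem : forall i, f (f i) = f i;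
  flat_c_idem : forall i, c i * c (f i) = c i;
  flat_c_root : forall i, zero_or_root (c i);
  mem_flat : forall x, x \in X <-> (forall i, x i 0 = c i * x (f i) 0);
  dim_flat : \dim X = #|free_coords f c| }.

(** Imposing x_j = u x_k eliminates the free coordinate j: what depended on x_j
    now depends on x_k. The equation x_j = 0 is the case u = 0, k = j. *)
Lemma monomial_flat_pivot X Y f c j k u :
  monomial_flat X f c -> j \in free_coords f c -> k \in free_coords f c ->
  zero_or_root u -> u = 0 \/ k != j -> (\dim Y).+1 = \dim X ->
  (forall x, (x \in Y) = (x \in X) && (x j 0 == u * x k 0)) ->
  monomial_flat Y (fun i => if f i == j then k else f i)
                  (fun i => if f i == j then c i * u else c i).
Proof.
case=> fK cK c_root X_eq dimX; rewrite !inE => /andP[/eqP fj /eqP cj].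
case/andP=> /eqP fk /eqP ck u_root u0kj dimY Y_eq; split.
- move=> i; case: (eqVneq (f i) j) => [_|/negbTE fi]; last by rewrite fK fi.
  by rewrite fk; case: eqP.
- move=> i; case: (eqVneq (f i) j) => [fij|/negbTE fi]; last by rewrite fK fi.
  rewrite fk; case: (eqVneq k j) u0kj => [-> [->|//]|_ _]; first by rewrite !mulr0.
  by rewrite ck mulr1.
- move=> i; case: ifP => // _; rewrite /zero_or_root mulf_eq0 exprMn.
  case/orP: (c_root i) => [->//|/eqP->].
  by case/orP: u_root => [->|/eqP->]; rewrite ?orbT ?mulr1 ?eqxx ?orbT.
- move=> x; rewrite Y_eq; split=> [/andP[/X_eq xX /eqP xj] i|xY].
    by case: eqP => // fi; rewrite xX fi xj mulrA.
  have xj : x j 0 = u * x k 0 by rewrite xY fj eqxx cj mul1r.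
  apply/andP; split; last exact/eqP.
  by apply/X_eq => i; rewrite xY; case: eqP => // fi; rewrite fi xj mulrA.
apply: succn_inj; rewrite dimY dimX (cardsD1 j) !inE fj cj !eqxx add1n.
congr _.+1; apply: eq_card => i; rewrite !inE.
case: (eqVneq i j) => [->|ij].
  rewrite fj eqxx cj mul1r; case: u0kj => [->|/negbTE->//].
  by rewrite [0 == 1]eq_sym oner_eq0 andbF.
case: (eqVneq (f i) j) => [fij|//]; rewrite fij eq_sym (negbTE ij) /=.
case: (eqVneq k i) => // ki; move: fij; rewrite -ki fk => kj.
by move: ij; rewrite -ki kj eqxx.
Qed.

Lemma flat_free X f c i : monomial_flat X f c -> c i != 0 -> f i \in free_coords f c.
Proof.
case=> fK cK _ _ _ ci; rewrite inE fK eqxx /=; apply/eqP.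
by apply: (mulfI ci); rewrite cK mulr1.
Qed.

Definition is_monomial_flat X := exists f c, monomial_flat X f c.

Lemma monomial_flat_full : is_monomial_flat fullv.
Proof.
exists id, (fun=> 1); split=> //.
- by move=> i; rewrite mul1r.
- by move=> i; rewrite /zero_or_root expr1n eqxx orbT.
- by move=> x; rewrite memvf; split=> // _ i; rewrite mul1r.
rewrite dimvf dim_matrix mulr1 -[LHS]card_ord.
by apply: eq_card => i; rewrite !inE !eqxx.
Qed.

Lemma monomial_flat_cap_hyp X a b z :
  zero_or_root z -> is_monomial_flat X -> is_monomial_flat (X :&: hyp a b z)%VS.
Proof.
move=> z_root flatX; case: (boolP (X <= hyp a b z)%VS) => [/capv_idPl->//|XNH].
case: flatX => f [c flatX].
have dimY := dim_cap_hyp XNH.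
(* On X, the equation x_a = z x_b reads c_a x_(f a) = z c_b x_(f b). As it is not
   an identity, it reduces to the form that monomial_flat_pivot accepts. *)
suff [j [k [u [jJ kJ u_root u0 eqH]]]]: exists j k u,
    [/\ j \in free_coords f c, k \in free_coords f c, zero_or_root u, u = 0 \/ k != j &
        forall x, x \in X -> (x \in hyp a b z) = (x j 0 == u * x k 0)].
  exists (fun i => if f i == j then k else f i),
         (fun i => if f i == j then c i * u else c i).
  apply: (monomial_flat_pivot flatX) => // x.
  by rewrite memv_cap; case xX: (x \in X) => //=; apply: eqH.
have flatE x : x \in X ->
    (x \in hyp a b z) = (c a * x (f a) 0 == z * c b * x (f b) 0).
  by move=> /(mem_flat flatX) xX; rewrite mem_hyp -mulrA -!xX.
have zero_or_root0 : zero_or_root 0 by rewrite /zero_or_root eqxx.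
case: (eqVneq (c a) 0) => [ca|ca]; case: (eqVneq (z * c b) 0) => [zcb|zcb].
- case/negP: XNH; apply/subvP => x xX; rewrite flatE // ca zcb.
  by rewrite !mul0r.
- have [z0 cb] : z != 0 /\ c b != 0.
    by apply/andP; rewrite -negb_or -mulf_eq0.
  have bJ := flat_free flatX cb.
  exists (f b), (f b), 0; split=> //; first by left.
  move=> x xX; rewrite flatE // ca !mul0r eq_sym mulf_eq0 (negbTE zcb) /=.
  by [].
- have aJ := flat_free flatX ca.
  exists (f a), (f a), 0; split=> //; first by left.
  by move=> x xX; rewrite flatE // zcb !mul0r mulf_eq0 (negbTE ca).
have [z0 cb] : z != 0 /\ c b != 0.
  by apply/andP; rewrite -negb_or -mulf_eq0.
have aJ := flat_free flatX ca; have bJ := flat_free flatX cb.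
case: (eqVneq (f b) (f a)) => [fba|fba].
  exists (f a), (f a), 0; split=> //; first by left.
  move=> x xX; rewrite flatE // fba mul0r -subr_eq0 -mulrBl mulf_eq0.
  case: (eqVneq (c a) (z * c b)) => [cazb|]; last by rewrite -subr_eq0 => /negbTE->.
  case/negP: XNH; apply/subvP => y yX; rewrite flatE // fba.
  by rewrite cazb.
exists (f a), (f b), (z * c b / c a); split=> //; last first.
- move=> x xX; rewrite flatE // -[RHS](inj_eq (mulfI ca)).
  by rewrite [c a * (_ / _ * _)]mulrA [c a * (_ / _)]mulrC mulfVK.
- by right.
have rootE w : w != 0 -> zero_or_root w -> w ^+ e = 1.
  by move=> w0; rewrite /zero_or_root (negbTE w0) => /eqP.
rewrite /zero_or_root exprMn exprVn exprMn !rootE ?invr1 ?mulr1 ?eqxx ?orbT //.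
all: exact: flat_c_root flatX _.
Qed.

End Flats.

(** * Points with coordinates in a finite set stable under roots of unity *)

Definition dowling_poly (e n : nat) : {poly int} :=
  \prod_(i < n) ('X - ((1 + i * e)%N%:Z)%:P).

Section Points.
Variables (K : fieldType) (e : nat) (S : seq K).

Record root_stable : Prop := RootStable {
  stable_uniq : uniq S;
  stable0 : 0 \in S;
  stableM : forall z s, z ^+ e = 1 -> s \in S -> z * s \in S }.

Hypothesis S_stable : root_stable.

Definition zero_sub : seq_sub S := SeqSub (stable0 S_stable).
Definition scale_sub (z : K) (t : seq_sub S) : seq_sub S :=
  insubd zero_sub (z * val t).

Lemma val_scale_sub z t : zero_or_root e z -> val (scale_sub z t) = z * val t.
Proof.
move=> z_root; rewrite /scale_sub insubdK //.
case/orP: z_root => /eqP; first by move=> ->; rewrite mul0r; apply: stable0.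
by move=> ze; apply: stableM => //; apply: valP.
Qed.

Lemma card_sub : #|{: seq_sub S}| = size S.
Proof. exact: card_seq_sub (stable_uniq S_stable). Qed.

Definition point r (t : {ffun 'I_r -> seq_sub S}) : 'cV[K]_r := \col_i val (t i).

(** The free coordinates of a point of X can be chosen in S at will; the others
    then are in S too. The choices are encoded as the maps to S that vanish
    outside the free coordinates. *)
Lemma card_flat r (X : {vspace 'cV[K]_r}) :
  is_monomial_flat e X -> #|[set t | point t \in X]| = (size S ^ \dim X)%N.
Proof.
case=> f [c flatX]; rewrite (dim_flat flatX) -card_sub.
set J := free_coords f c; pose B := pffun_on zero_sub J predT.
rewrite -[RHS](card_pffun_on zero_sub _ predT) -/B.
pose ext (g : {ffun 'I_r -> seq_sub S}) :=
  [ffun i => scale_sub (c i) (g (f i))].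
have extJ g i : i \in J -> ext g i = g i.
  rewrite inE => /andP[/eqP fi /eqP ci]; apply: val_inj.
  by rewrite ffunE val_scale_sub ?(flat_c_root flatX) // ci fi mul1r.
have BJ g i : g \in B -> i \notin J -> g i = zero_sub.
  by move=> gB; case/pffun_onP: gB => /supportP gJ _; apply: gJ.
rewrite -(@card_in_imset _ _ ext B); last first.
  move=> g h gB hB /ffunP gh; apply/ffunP => i.
  case: (boolP (i \in J)) => iJ; first by rewrite -(extJ g) // -(extJ h) // gh.
  by rewrite !BJ.
apply: eq_card => t; rewrite inE; apply/idP/imsetP => [/(mem_flat flatX) tX|].
  exists [ffun i => if i \in J then t i else zero_sub].
    apply/pffun_onP; split=> [|z _ //]; apply/supportP => i /negbTE iJ.
    by rewrite ffunE iJ.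
  apply/ffunP => i; apply: val_inj; move: (tX i).
  rewrite !ffunE !mxE val_scale_sub ?(flat_c_root flatX) // => ->.
  case: (eqVneq (c i) 0) => [->|ci]; first by rewrite !mul0r.
  by rewrite (flat_free flatX).
case=> g _ ->; apply/(mem_flat flatX) => i; rewrite !mxE !ffunE.
rewrite !val_scale_sub ?(flat_c_root flatX) //.
by rewrite (flat_f_idem flatX) mulrA (flat_c_idem flatX).
Qed.

Definition insert n (i : 'I_n.+1) (t : seq_sub S) (y : {ffun 'I_n -> seq_sub S}) :
    {ffun 'I_n.+1 -> seq_sub S} :=
  [ffun k => if unlift i k is Some k' then y k' else t].

Lemma insert_lift n (i : 'I_n.+1) t y k : insert i t y (lift i k) = y k.
Proof. by rewrite ffunE liftK. Qed.

Lemma insert_at n (i : 'I_n.+1) t (y : {ffun 'I_n -> seq_sub S}) : insert i t y i = t.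
Proof. by rewrite ffunE unlift_none. Qed.

Lemma card_insert n (i : 'I_n.+1) (Q : pred {ffun 'I_n.+1 -> seq_sub S}) :
  #|[set x | Q x]| =
    (\sum_(y : {ffun 'I_n -> seq_sub S}) #|[set t | Q (insert i t y)]|)%N.
Proof.
rewrite -sum1_card big_mkcond /=.
rewrite (reindex (fun p : {ffun 'I_n -> seq_sub S} * seq_sub S => insert i p.2 p.1)).
  rewrite -(pair_bigA _ (fun y t => if insert i t y \in [set x | Q x] then 1 else 0)%N) /=.
  apply: eq_bigr => y _; rewrite -sum1_card [RHS]big_mkcond /=.
  by apply: eq_bigr => t _; rewrite !inE.
apply: onW_bij; exists (fun x : {ffun 'I_n.+1 -> seq_sub S} =>
    ([ffun k : 'I_n => x (lift i k)], x i)) => [[y t]|x] /=.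
  by rewrite insert_at; congr (_, _); apply/ffunP => k; rewrite ffunE insert_lift.
apply/ffunP => k; case: (unliftP i k) => [k' ->|->].
  by rewrite insert_lift ffunE.
by rewrite insert_at.
Qed.

(** Two nonzero scalars have the same e-th power when one is the product of the
    other by an e-th root of unity, so these are the points on no hyperplane
    x_i = 0 or x_i = z x_j; see [generic_off_hyps]. *)
Definition generic n (y : {ffun 'I_n -> seq_sub S}) : bool :=
  [forall i, val (y i) != 0] && injectiveb (fun i => val (y i) ^+ e).

Lemma genericP n (y : {ffun 'I_n -> seq_sub S}) :
  reflect ((forall i, val (y i) != 0) /\ injective (fun i => val (y i) ^+ e))
          (generic y).
Proof.
by apply: (iffP andP) => -[/forallP y0 /injectiveP y_inj].
Qed.

Variable U : seq K.
Hypotheses (e_gt0 : (0 < e)%N) (U_uniq : uniq U) (U_size : size U = e).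
Hypothesis U_root : forall z, (z \in U) = (z ^+ e == 1).

Lemma root_ratio (a b : K) : b != 0 -> a ^+ e = b ^+ e -> a / b \in U.
Proof. by move=> b0 ab; rewrite U_root exprMn exprVn ab divff // expf_neq0. Qed.

(** The values forbidden to a new coordinate are 0 and the e multiples of each
    earlier one by roots of unity; these are pairwise distinct. *)
Lemma card_generic_insert n (y : {ffun 'I_n -> seq_sub S}) :
  generic y ->
  (#|[set t | generic (insert ord0 t y)]| + (1 + n * e) = size S)%N.
Proof.
move=> /genericP[y0 y_inj].
pose bad := 0 :: [seq z * val (y i) | i <- enum 'I_n, z <- U].
have badP s : s != 0 -> s \in bad = [exists i, val (y i) ^+ e == s ^+ e].
  move=> s0; rewrite inE (negbTE s0) /=.
  apply/allpairsP/existsP => [[[i z] /=]|[i /eqP si]].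
    case=> _; rewrite U_root => /eqP ze ->; exists i.
    by rewrite exprMn ze mul1r.
  exists (i, s / val (y i)); split=> /=; first by rewrite mem_enum.
    exact: root_ratio (y0 i) (esym si).
  by rewrite divfK // (y0 i).
have bad_uniq : uniq bad.
  rewrite /= allpairs_uniq ?enum_uniq // ?andbT.
    apply/negP => /allpairsP[[i z] /= [_]]; rewrite U_root => /eqP ze /eqP.
    rewrite eq_sym mulf_eq0 (negbTE (y0 i)) orbF.
    by rewrite (negbTE (unity_root_neq0 e_gt0 ze)).
  move=> p q /allpairsP[[i z] /= [_ zU ->]] /allpairsP[[j w] /= [_ wU ->]] /= zw.
  have ij : i = j.
    apply: y_inj => /=; move: (congr1 (fun s => s ^+ e) zw); rewrite /= !exprMn.
    by move: zU wU; rewrite !U_root => /eqP-> /eqP->; rewrite !mul1r.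
  by rewrite ij in zw *; rewrite (mulIf (y0 j) zw).
have bad_size : size bad = (1 + n * e)%N.
  by rewrite /= size_allpairs U_size -cardE card_ord.
have badS : {subset bad <= S}.
  move=> s; rewrite inE => /orP[/eqP->|]; first exact: stable0.
  case/allpairsP=> [[i z] /= [_ zU ->]]; apply: stableM => //; last exact: valP.
  by apply/eqP; rewrite -U_root.
pose badT := [set t : seq_sub S | val t \in bad].
have badT_size : #|badT| = (1 + n * e)%N.
  rewrite -bad_size -[RHS](count_predT bad).
  have -> : count predT bad = count (fun s => s \in S) bad.
    by apply: eq_in_count => s /badS ->.
  rewrite -(size_pmap_sub (seq_sub S)).
  rewrite -(card_uniqP (pmap_sub_uniq _ bad_uniq)).
  by apply: eq_card => t; rewrite inE mem_pmap_sub.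
rewrite -badT_size -card_sub addnC -[RHS](cardC badT); congr (_ + _)%N.
apply: eq_card => t; rewrite !inE /=.
case: (eqVneq (val t) 0) => [t0|t0] /=.
  by apply/negP => /genericP[/(_ ord0)]; rewrite insert_at t0 eqxx.
have := badP _ t0; rewrite inE (negbTE t0) /= => ->.
rewrite negb_exists; apply/genericP/forallP => [[x0 x_inj] i|yt].
  apply/eqP => yit; have := x_inj (lift ord0 i) ord0.
  by rewrite insert_lift insert_at => /(_ yit).
split=> [k|k l].
  by case: (unliftP ord0 k) => [k' ->|->]; rewrite ?insert_lift ?insert_at.
case: (unliftP ord0 k) => [k' ->|->]; case: (unliftP ord0 l) => [l' ->|->] //.
- by rewrite !insert_lift => /y_inj->.
- by rewrite insert_lift insert_at => yt'; case/eqP: (yt k').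
- by rewrite insert_lift insert_at => yt'; case/eqP: (yt l').
Qed.

Lemma card_generic n :
  #|[set y : {ffun 'I_n -> seq_sub S} | generic y]|%:Z =
  (dowling_poly e n).[(size S)%:Z].
Proof.
rewrite /dowling_poly; elim: n => [|n IHn].
  rewrite big_ord0 hornerC (@eq_card _ _ predT) ?card_ffun ?card_ord // => y.
  by rewrite !inE; apply/genericP; split=> -[].
rewrite big_ord_recr /= hornerM hornerXsubC -IHn (card_insert ord0).
rewrite -sum1_card -!natz !natr_sum mulr_suml [RHS]big_mkcond.
apply: eq_bigr => y _; rewrite inE; case: ifP => [y_gen|/negP y_gen].
  rewrite -[in RHS](card_generic_insert y_gen) mul1r !natz PoszD.
  by rewrite addrK.
rewrite eq_card0 // => t; rewrite !inE; apply/negP => /genericP[x0 x_inj].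
apply: y_gen; apply/genericP; split=> [i|i j].
  by have := x0 (lift ord0 i); rewrite insert_lift.
have := x_inj (lift ord0 i) (lift ord0 j); rewrite !insert_lift.
by move=> h /h /lift_inj.
Qed.
End Points.

(** * The arrangement and its characteristic polynomials *)

Section Arrangement.
Variables (K : fieldType) (e : nat) (U : seq K).
Hypotheses (e_gt0 : (0 < e)%N) (U_uniq : uniq U) (U_size : size U = e).
Hypothesis U_root : forall z, (z \in U) = (z ^+ e == 1).

Definition increasing_pairs r :=
  [seq p : 'I_r * 'I_r <- enum {: 'I_r * 'I_r} | (p.1 < p.2)%N].

Definition monomial_hyps r : seq {vspace 'cV[K]_r} :=
  [seq hyp i i 0 | i <- enum 'I_r] ++
  [seq hyp p.1 p.2 z | p <- increasing_pairs r, z <- U].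

Definition monomial_arr r : {fset {vspace 'cV[K]_r}} := [fset H in monomial_hyps r]%fset.

Lemma zero_or_rootV (z : K) : zero_or_root e z -> zero_or_root e z^-1.
Proof. by rewrite /zero_or_root invr_eq0 exprVn invr_eq1. Qed.

Lemma U_neq0 z : z \in U -> z != 0.
Proof.
by rewrite U_root => /eqP; apply: unity_root_neq0.
Qed.

(** Since r > 1, a coordinate hyperplane has a second index j != i, and all the
    members have the same form. *)
Lemma monomial_arrP r H : (1 < r)%N ->
  reflect (exists i j z, [/\ i != j, zero_or_root e z & H = hyp i j z])
          (H \in monomial_arr r).
Proof.
move=> r_gt1; rewrite in_fset /= mem_cat; apply: (iffP orP) => [[]|].
- case/mapP=> i _ ->.
  have [j ij] := neq_ord_exists i r_gt1.
  by exists i, j, 0; split; [|rewrite /zero_or_root eqxx|exact: hyp0].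
- case/allpairsP=> -[[i j] z] /= []; rewrite mem_filter /= => /andP[ij _] zU ->.
  by exists i, j, z; split=> //; rewrite ?neq_ltn ?ij // /zero_or_root -U_root zU orbT.
case=> i [j [z [ij z_root ->]]]; case: (eqVneq z 0) => [->|z0].
  by left; rewrite (hyp0 K i j i); apply: map_f; rewrite mem_enum.
have zU : z \in U by move: z_root; rewrite /zero_or_root (negbTE z0) U_root.
right; apply/allpairsP; move: ij; rewrite neq_ltn => /orP[ij|ji].
  by exists ((i, j), z); split; rewrite // mem_filter ij mem_enum.
exists ((j, i), z^-1); split; last exact: hypV.
  by rewrite mem_filter /= ji mem_enum.
rewrite /= U_root; move: (zero_or_rootV z_root).
by rewrite /zero_or_root invr_eq0 (negbTE z0).
Qed.

Lemma delta_hypE r (i j k : 'I_r) (z : K) : z != 0 -> i != j ->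
  (delta_mx k 0 \in hyp i j z) = (k \notin [:: i; j]).
Proof.
move=> z0 ij; rewrite !inE negb_or.
case: (eqVneq k i) => [->|ki] /=; first by apply/negbTE/delta_notin_hyp; left.
case: (eqVneq k j) => [->|kj] /=; last exact: delta_in_hyp.
rewrite hypV //; apply/negbTE/delta_notin_hyp; left.
by rewrite eq_sym.
Qed.

(** The basis vectors that a hyperplane of the family misses tell i and j; then
    the vector with coordinates z at i and 1 elsewhere tells z. *)
Lemma monomial_hyps_uniq r : uniq (monomial_hyps r).
Proof.
have hyp00 (i k : 'I_r) : (delta_mx k 0 \in hyp i i (0 : K)) = (k != i).
  case: (eqVneq k i) => [->|ki]; last exact: delta_in_hyp.
  by apply/negbTE/delta_notin_hyp; right.
rewrite cat_uniq; apply/and3P; split.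
- rewrite map_inj_uniq ?enum_uniq // => i j ij.
  by apply/eqP; rewrite -[_ == _]negbK -hyp00 -ij hyp00 eqxx.
- apply/hasPn => H /allpairsP[[[i j] z] /= []].
  rewrite mem_filter /= => /andP[ij _] /U_neq0 z0 ->.
  have ij' : i != j by rewrite neq_ltn ij.
  apply/negP => /mapP[k _ E].
  have := delta_hypE i z0 ij'; have := delta_hypE j z0 ij'.
  rewrite E !hyp00 !inE !eqxx orbT /= => /negbFE/eqP jk /negbFE/eqP ik.
  by case/eqP: ij'; rewrite ik jk.
apply: allpairs_uniq => // [|p q]; first exact: filter_uniq (enum_uniq _).
case/allpairsP=> -[[i j] z] /= []; rewrite mem_filter /= => /andP[ij _] /U_neq0 z0 ->.
case/allpairsP=> -[[k l] w] /= []; rewrite mem_filter /= => /andP[kl _] /U_neq0 w0 ->.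
move=> E; have E' v : (v \in hyp i j z) = (v \in hyp k l w) by rewrite [hyp i j z]E.
have ij' : i != j by rewrite neq_ltn ij.
have kl' : k != l by rewrite neq_ltn kl.
have := E' (delta_mx i 0); have := E' (delta_mx j 0).
have := E' (delta_mx k 0); have := E' (delta_mx l 0).
rewrite /= !delta_hypE // !inE !eqxx !orbT /=.
move=> /negbFE lij /negbFE kij /esym/negbFE jkl /esym/negbFE ikl.
have [ik jl] : i = k /\ j = l.
  split; apply: val_inj; move: lij kij jkl ikl ij kl; rewrite -!val_eqE /=; lia.
move: (E' (\col_m (if m == i then z else 1))); rewrite -ik -jl.
rewrite !mem_hyp !mxE eqxx [j == i]eq_sym (negbTE ij') !mulr1 eqxx.
by move=> /esym/eqP->.
Qed.

Lemma size_increasing_pairs r : size (increasing_pairs r) = 'C(r, 2).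
Proof.
rewrite size_filter -sum1_count big_enum_cond /=.
rewrite -(pair_big_dep xpredT (fun i j : 'I_r => i < j)%N (fun _ _ => 1%N)) /=.
rewrite (exchange_big_dep xpredT) //= -bin2_sum big_mkord.
apply: eq_bigr => j _.
by rewrite -(big_ord_widen r (fun=> 1%N) (ltnW (ltn_ord j))) sum1_card card_ord.
Qed.

Lemma card_monomial_arr r : #|` monomial_arr r| = (r + e * 'C(r, 2))%N.
Proof.
have /perm_size -> : perm_eq (monomial_arr r) (monomial_hyps r).
  apply: uniq_perm; rewrite ?fset_uniq ?monomial_hyps_uniq // => H.
  by rewrite in_fset.
rewrite size_cat size_map size_allpairs size_increasing_pairs U_size.
by rewrite -cardE card_ord mulnC.
Qed.

Lemma is_arrangement_monomial r : (1 < r)%N -> is_arrangement fullv (monomial_arr r).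
Proof.
move=> r_gt1 H /(monomial_arrP _ r_gt1)[i [j [z [ij _ ->]]]].
rewrite subvf dim_hyp; last by left.
by rewrite dimvf dim_matrix mulr1.
Qed.

Lemma coord_hyp_in_arr r (i : 'I_r) : hyp i i 0 \in monomial_arr r.
Proof. by rewrite in_fset /= mem_cat (map_f (fun k => hyp k k 0)) ?mem_enum. Qed.

Lemma essential_monomial r : (1 < r)%N -> essential fullv (monomial_arr r).
Proof.
move=> r_gt1; apply/eqP; rewrite -subv0; apply/subvP => x.
rewrite memv_cap memv_bigcap_seq => /andP[_ /allP xA].
rewrite memv0; apply/eqP/colP => i; rewrite mxE; apply/eqP.
by have := xA _ (coord_hyp_in_arr i); rewrite mem_hyp mul0r.
Qed.

Lemma flat_bigcap r (V : {vspace 'cV[K]_r}) (s : seq {vspace 'cV[K]_r}) :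
  (forall Y, Y \in s -> forall X,
     is_monomial_flat e X -> is_monomial_flat e (X :&: Y)%VS) ->
  is_monomial_flat e V -> is_monomial_flat e (V :&: \bigcap_(H <- s) H)%VS.
Proof.
elim: s V => [|H s IHs] V cap_s flatV; first by rewrite big_nil capvf.
rewrite big_cons capvA; apply: IHs => [Y Ys|]; last by apply: cap_s; rewrite ?mem_head.
by apply: cap_s; rewrite inE Ys orbT.
Qed.

Lemma lattice_flat r X : (1 < r)%N -> X \in lattice fullv (monomial_arr r) ->
  is_monomial_flat e X.
Proof.
move=> r_gt1 /latticeP[B BA ->]; apply: flat_bigcap; last exact: monomial_flat_full.
move=> Y YB X' flatX.
have /(monomial_arrP _ r_gt1)[i [j [z [_ z_root ->]]]] := fsubsetP BA _ YB.
exact: monomial_flat_cap_hyp.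
Qed.

(** The flats of the restriction to H are flats of the arrangement itself. *)
Lemma restriction_lattice_flat r H X : (1 < r)%N -> H \in monomial_arr r ->
  X \in lattice H (restriction (monomial_arr r) H) -> is_monomial_flat e X.
Proof.
move=> r_gt1 HA /latticeP[B BA ->].
have capA H' Y : H' \in monomial_arr r -> is_monomial_flat e Y ->
    is_monomial_flat e (Y :&: H')%VS.
  move=> /(monomial_arrP _ r_gt1)[i [j [z [_ z_root ->]]]].
  exact: monomial_flat_cap_hyp.
apply: flat_bigcap; last by rewrite -(capfv H); apply: capA (monomial_flat_full _ _ _).
move=> Y /(fsubsetP BA) /imfsetP[H' /= ]; rewrite inE => /andP[H'A _] -> X' flatX.
rewrite capvA; apply: (capA _ _ H'A); exact: (capA _ _ HA).
Qed.

Lemma subv_monomial_arr r H H' : (1 < r)%N ->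
  H \in monomial_arr r -> H' \in monomial_arr r -> (H <= H')%VS = (H == H').
Proof.
move=> r_gt1 HA H'A; rewrite eqEdim; case: (H <= H')%VS => //=; apply/esym.
have [_ dH] := is_arrangement_monomial r_gt1 HA.
have [_ dH'] := is_arrangement_monomial r_gt1 H'A.
by rewrite -ltnS dH dH' leqnn.
Qed.

Section CharPoly.
Variables (S : seq K).
Hypothesis S_stable : root_stable e S.

Lemma generic_off_hyps r (t : {ffun 'I_r -> seq_sub S}) : (1 < r)%N ->
  [forall H : monomial_arr r, point t \notin val H] = generic e t.
Proof.
move=> r_gt1; apply/forallP/genericP => [t_off|[t0 t_inj] [H HA] /=]; last first.
  have /(monomial_arrP _ r_gt1)[i [j [z [ij z_root ->]]]] := HA.
  rewrite mem_hyp !mxE; apply/negP => /eqP tij.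
  case/orP: z_root => /eqP ze.
    by move: (t0 i); rewrite tij ze mul0r eqxx.
  by case/eqP: ij; apply: t_inj; rewrite /= tij exprMn ze mul1r.
have off i j z : i != j -> zero_or_root e z -> val (t i) <> z * val (t j).
  move=> ij z_root tij.
  have HA : hyp i j z \in monomial_arr r.
    by apply/(monomial_arrP _ r_gt1); exists i, j, z.
  by have := t_off [` HA]%fset; rewrite /= mem_hyp !mxE tij eqxx.
have t0 i : val (t i) != 0.
  apply/eqP => ti0.
  by have := t_off [` coord_hyp_in_arr i]%fset; rewrite /= mem_hyp !mxE ti0 mul0r eqxx.
split=> // i j tij; apply/eqP/negPn/negP => ij.
apply: (off i j (val (t i) / val (t j))) => //; last by rewrite divfK.
by rewrite /zero_or_root -U_root (root_ratio U_root) ?orbT.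
Qed.

Lemma char_poly_full_eval r : (1 < r)%N ->
  (char_poly_arr fullv (monomial_arr r)).[(size S)%:Z] =
  (dowling_poly e r).[(size S)%:Z].
Proof.
move=> r_gt1; rewrite -(card_generic S_stable e_gt0 U_uniq U_size U_root).
rewrite (char_poly_arr_count (pt := @point K S r) (q := size S)).
- congr (Posz _); apply: eq_card => t.
  by rewrite !inE memvf generic_off_hyps.
- move=> H HA; have [_ dH] := is_arrangement_monomial r_gt1 HA.
  by apply/negP => /dimvS; rewrite -dH ltnn.
by move=> X /(lattice_flat r_gt1); apply: card_flat.
Qed.

(** The i-th basis vector lies on the first hyperplane only. *)
Lemma hyp_neq_index r (i j k l : 'I_r) z w : i != j -> k != i -> l != i ->
  hyp k l w != hyp i j z :> {vspace 'cV[K]_r}.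
Proof.
move=> ij ki li; apply/eqP => E.
have := delta_notin_hyp (z := z) (or_introl ij).
by rewrite -E delta_in_hyp // eq_sym.
Qed.

(** A point x of the hyperplane x_i = z x_j is recovered from y, the point
    without its i-th coordinate. A hyperplane that involves x_i becomes, by
    substitution of z x_j for x_i, a hyperplane in y, unless it is the given one:
    so x is on no other hyperplane exactly when y is on none. *)
Lemma insert_off_hyps n (i j : 'I_n.+1) z (y : {ffun 'I_n -> seq_sub S}) t j' :
  (1 < n.+1)%N -> j = lift i j' -> zero_or_root e z -> val t = z * val (y j') ->
  reflect (forall H, H \in monomial_arr n.+1 -> H != hyp i j z ->
             point (insert i t y) \notin H)
          (generic e y).
Proof.
move=> r_gt1 jE z_root tE; set x := point _.
have ij : i != j by rewrite jE neq_lift.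
have xi : x i 0 = z * val (y j') by rewrite mxE insert_at.
have xl k : x (lift i k) 0 = val (y k) by rewrite mxE insert_lift.
apply: (iffP (genericP _ _)) => [[y0 y_inj] H|x_off].
  case/(monomial_arrP _ r_gt1)=> k [l [w [kl w_root ->]]] Hne.
  rewrite mem_hyp; apply/negP => /eqP xkl.
  (* x_i may be assumed to stand on the left of the equation, if it occurs. *)
  wlog li : k l w kl w_root Hne xkl / l != i.
    move=> IH; case: (eqVneq l i) => [li|]; last by move=> li; apply: (IH k l w).
    have ki : k != i by rewrite -li.
    have [|k' kE _] := @unlift_some _ i k; first by rewrite eq_sym.
    case: (eqVneq w 0) => [w0|w0].
      by move: (y0 k'); rewrite -xl -kE xkl w0 mul0r eqxx.
    apply: (IH l k w^-1) => //; first by rewrite eq_sym.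
    - exact: zero_or_rootV.
    - by rewrite -hypV.
    by rewrite xkl mulKf.
  have [|l' lE _] := @unlift_some _ i l; first by rewrite eq_sym.
  have root_wE : w != 0 -> w ^+ e = 1.
    by move=> w0; move: w_root; rewrite /zero_or_root (negbTE w0) => /eqP.
  case: (unliftP i k) => [k' kE|kE].
    have yk : val (y k') = w * val (y l') by rewrite -!xl -kE -lE.
    case: (eqVneq w 0) => [w0|/root_wE we].
      by move: (y0 k'); rewrite yk w0 mul0r eqxx.
    by case/eqP: kl; rewrite kE lE; congr lift; apply: y_inj;
      rewrite /= yk exprMn we mul1r.
  have yl : z * val (y j') = w * val (y l') by rewrite -(xl l') -lE -xi -xkl kE.
  case: (eqVneq w 0) => [w0|w0].
    move: yl Hne; rewrite w0 mul0r kE => /eqP; rewrite mulf_eq0 (negbTE (y0 j')) orbF.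
    by move=> /eqP ->; rewrite (hyp0 K i l j) eqxx.
  have z0 : z != 0.
    apply: contraNneq (mulf_neq0 w0 (y0 l')) => z0.
    by rewrite -yl z0 mul0r.
  have ze : z ^+ e = 1 by move: z_root; rewrite /zero_or_root (negbTE z0) => /eqP.
  have jl : j' = l'.
    apply: y_inj; move: (congr1 (fun s => s ^+ e) yl).
    by rewrite /= !exprMn ze root_wE // !mul1r.
  case/eqP: Hne; rewrite kE lE jE jl; congr hyp; rewrite -jl in yl.
  by apply: (mulIf (y0 j')).
have lift_neq k : lift i k != i by rewrite eq_sym neq_lift.
have off k' l' w : zero_or_root e w -> k' != l' -> val (y k') <> w * val (y l').
  move=> w_root kl ykl.
  have HA : hyp (lift i k') (lift i l') w \in monomial_arr n.+1.
    apply/(monomial_arrP _ r_gt1); exists (lift i k'), (lift i l'), w; split=> //.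
    by rewrite (inj_eq lift_inj).
  have := x_off _ HA (hyp_neq_index _ _ ij (lift_neq k') (lift_neq l')).
  by rewrite mem_hyp !xl ykl eqxx.
have y0 k' : val (y k') != 0.
  apply/eqP => yk.
  have := x_off _ (coord_hyp_in_arr _) (hyp_neq_index _ _ ij (lift_neq k') (lift_neq k')).
  by rewrite mem_hyp !xl yk mul0r eqxx.
split=> // k' l' ykl; apply/eqP/negPn/negP => kl.
apply: (off k' l' (val (y k') / val (y l'))) => //; last by rewrite divfK.
by rewrite /zero_or_root -U_root (root_ratio U_root) ?orbT.
Qed.

Lemma char_poly_restriction_eval n H : (1 < n.+1)%N -> H \in monomial_arr n.+1 ->
  (char_poly_arr H (restriction (monomial_arr n.+1) H)).[(size S)%:Z] =
  (dowling_poly e n).[(size S)%:Z].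
Proof.
move=> r_gt1 HA; rewrite -(card_generic S_stable e_gt0 U_uniq U_size U_root).
have restrP (H' : {vspace 'cV[K]_n.+1}) :
    reflect (exists2 G, (G \in monomial_arr n.+1) && (G != H) & H' = (H :&: G)%VS)
            (H' \in restriction (monomial_arr n.+1) H).
  apply: (iffP (imfsetP _ _ _ _)) => -[G /=].
    rewrite inE => /andP[GA HG] ->; exists G => //.
    by rewrite GA eq_sym -subv_monomial_arr.
  case/andP=> GA GH ->; exists G => //.
  by rewrite inE GA subv_monomial_arr // eq_sym.
rewrite (char_poly_arr_count (pt := @point K S n.+1) (q := size S)); last first.
- by move=> X /(restriction_lattice_flat r_gt1 HA); apply: card_flat.
- move=> _ /restrP[G /andP[GA GH] ->]; rewrite subv_cap subvv /=.
  by rewrite subv_monomial_arr // eq_sym.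
have [i [j [z [ij z_root HE]]]] := monomial_arrP _ r_gt1 HA.
have [j' jE _] := unlift_some ij.
congr (Posz _); rewrite (card_insert i) -sum1_card [RHS]big_mkcond /=.
apply: eq_bigr => y _; rewrite inE.
set t0 := scale_sub S_stable z (y j').
have t0E : val t0 = z * val (y j') by rewrite val_scale_sub.
have HtE t : (point (insert i t y) \in H) = (t == t0).
  rewrite HE mem_hyp !mxE jE insert_at insert_lift -t0E.
  by rewrite (inj_eq val_inj).
have restr_off t : t = t0 ->
    [forall G : restriction (monomial_arr n.+1) H, point (insert i t y) \notin val G]
    = generic e y.
  move=> tE; have tE' : val t = z * val (y j') by rewrite tE.
  apply/forallP/(insert_off_hyps r_gt1 jE z_root tE') => [off G GA GH|off [G GR] /=].
    have GR : (H :&: G)%VS \in restriction (monomial_arr n.+1) H.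
      by apply/restrP; exists G; rewrite // GA HE.
    have := off [` GR]%fset; rewrite /= memv_cap negb_and => /orP[|//].
    by rewrite HtE tE eqxx.
  case/restrP: GR => G' /andP[GA GH] ->; rewrite memv_cap negb_and (off G') ?orbT //.
  by rewrite -HE.
case: ifP => y_gen.
  transitivity #|[set t0]|; last exact: cards1.
  apply: eq_card => t; rewrite !inE HtE.
  by case: eqP => //= tE; rewrite restr_off.
rewrite eq_card0 // => t; rewrite !inE HtE.
by case: eqP => //= tE; rewrite restr_off.
Qed.

End CharPoly.
End Arrangement.

(** * Simpliciality over a field with enough roots of unity *)

Lemma eq_int_poly (p q : {poly int}) (a : nat -> int) :
  injective a -> (forall N, p.[a N] = q.[a N]) -> p = q.
Proof.
move=> a_inj pq; apply/eqP; rewrite -subr_eq0; apply/negP => /negP pq0.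
pose rs := [seq a N | N <- iota 0 (size (p - q))].
have := @max_poly_roots _ (p - q) rs pq0; rewrite size_map size_iota ltnn.
rewrite map_inj_uniq ?iota_uniq // => H; suff: false by []; apply: H => //.
apply/allP => _ /mapP[N _ ->].
by rewrite /root hornerD hornerN pq subrr.
Qed.

Section Roots.
Variables (K : numClosedFieldType).

Lemma unity_roots_exist e : (0 < e)%N ->
  exists U : seq K, [/\ uniq U, size U = e & forall z, (z \in U) = (z ^+ e == 1)].
Proof.
move=> e_gt0; have [U UE] := closed_field_poly_normal ('X^e - 1 : {poly K}).
rewrite (eqP (monicXnsubC _ e_gt0)) scale1r in UE.
exists U; split.
- by rewrite -separable_prod_XsubC -UE separable_Xn_sub_1 // pnatr_eq0 -lt0n.
- have := congr1 (fun p : {poly K} => size p) UE.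
  by rewrite /= size_XnsubC // size_prod_XsubC => -[].
by move=> z; rewrite -root_prod_XsubC -UE /root !hornerE subr_eq0.
Qed.

Variables (e : nat) (U : seq K).
Hypotheses (e_gt0 : (0 < e)%N) (U_uniq : uniq U) (U_size : size U = e).
Hypothesis U_root : forall z, (z \in U) = (z ^+ e == 1).

(** Distinct positive integers have distinct e-th powers, so that their multiples
    by roots of unity do not meet. *)
Definition sample N : seq K := 0 :: [seq k.+1%:R * z | k <- iota 0 N, z <- U].

Lemma sample_stable N : root_stable e (sample N).
Proof.
split; rewrite ?mem_head //.
- rewrite /= allpairs_uniq ?iota_uniq // ?andbT.
    apply/negP => /allpairsP[[k z] /= [_ zU /eqP]].
    by rewrite eq_sym mulf_eq0 pnatr_eq0 /= (negbTE (U_neq0 e_gt0 U_root zU)).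
  move=> p q /allpairsP[[k z] /= [_ zU ->]] /allpairsP[[l w] /= [_ wU ->]] /= kz.
  have kl : k = l.
    move: (congr1 (fun s => s ^+ e) kz); rewrite /= !exprMn.
    move: zU wU; rewrite !U_root => /eqP-> /eqP->; rewrite !mulr1 => /eqP.
    by rewrite eqrXn2 ?ler0n // eqr_nat eqSS => /eqP.
  by rewrite kl in kz *; rewrite (mulfI _ kz) // pnatr_eq0.
move=> z s ze; rewrite !inE => /orP[/eqP->|/allpairsP[[k w] /= [kN wU ->]]].
  by rewrite mulr0 eqxx.
apply/orP; right; apply/allpairsP; exists (k, z * w); split=> //=; last by rewrite mulrCA.
by move: wU; rewrite !U_root exprMn ze mul1r.
Qed.

Lemma size_sample N : size (sample N) = (1 + N * e)%N.
Proof. by rewrite /= size_allpairs size_iota U_size. Qed.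

Lemma sample_size_inj : injective (fun N => (size (sample N))%:Z).
Proof.
move=> M N /eqP; rewrite eqz_nat !size_sample eqn_add2l eqn_pmul2r //.
by move/eqP.
Qed.

Lemma char_poly_full r : (1 < r)%N ->
  char_poly_arr fullv (monomial_arr U r) = dowling_poly e r.
Proof.
move=> r_gt1; apply: (eq_int_poly sample_size_inj) => N.
apply: char_poly_full_eval => //.
exact: sample_stable.
Qed.

Lemma char_poly_restriction n H : (1 < n.+1)%N -> H \in monomial_arr U n.+1 ->
  char_poly_arr H (restriction (monomial_arr U n.+1) H) = dowling_poly e n.
Proof.
move=> r_gt1 HA; apply: (eq_int_poly sample_size_inj) => N.
apply: char_poly_restriction_eval => //.
exact: sample_stable.
Qed.

Lemma monomial_arr_simplicial r : (1 < r)%N ->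
  combinatorially_simplicial [set` monomial_arr U r].
Proof.
case: r => // n r_gt1; split; first exact: finite_fset.
rewrite set_fsetK; split.
- exact: is_arrangement_monomial.
- exact: essential_monomial.
rewrite big_seq (eq_bigr (fun=> (dowling_poly e n).[-1])); last first.
  by move=> H HA; rewrite char_poly_restriction.
rewrite -big_seq big_const_seq count_predT iter_addr_0.
rewrite (card_monomial_arr e_gt0 U_uniq U_size U_root) char_poly_full //.
rewrite {1}/dowling_poly big_ord_recr /= -/(dowling_poly e n) hornerM hornerXsubC.
set c := (dowling_poly e n).[-1].
have C2 : (2 * 'C(n.+1, 2) = n.+1 * n)%N.
  by rewrite bin2 mul2n -[RHS]odd_double_half oddM /= andNb.
rewrite -[c *+ _]mulr_natl.
have E : 2 * (n.+1 + e * 'C(n.+1, 2))%N%:Z = n.+1%:Z * (2 + n%:Z * e%:Z).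
  by rewrite -[2]/(2%:Z) -PoszM mulnDr mulnCA C2; lia.
rewrite [2 * (_ * c)]mulrA [(_ + _)%:R]natz E PoszD PoszM.
ring.
Qed.
End Roots.

(** * The reflections of G(e,d,r) *)

Section Reflections.
Variables (K : fieldType) (r : nat).
Implicit Types (g : 'M[K]_r) (s t : {perm 'I_r}) (c : 'I_r -> K) (x : 'cV[K]_r).

Lemma fix_mxP g x : reflect (forall i, (g *m x) i 0 = x i 0) (x \in fix_mx g).
Proof.
apply: (iffP fixedSpaceP); rewrite lfunE /=; first by move=> ->.
by move=> gx; apply/colP.
Qed.

Lemma monomial_row_mul g x i k : monomial_mx g -> g i k != 0 ->
  (g *m x) i 0 = g i k * x k 0.
Proof.
case=> /(_ i) [k' [_ k'_uniq]] _ gik; rewrite mxE (bigD1 k) //= big1 ?addr0 // => l lk.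
case: (eqVneq (g i l) 0) => [->|gil]; first by rewrite mul0r.
by move: lk; rewrite -(k'_uniq _ gil) -(k'_uniq _ gik) eqxx.
Qed.

Definition perm_scale_mx s c : 'M[K]_r := \matrix_(k, l) (c k *+ (l == s k)).

Lemma perm_scale_mulE s c n (B : 'M[K]_(r, n)) k l :
  (perm_scale_mx s c *m B) k l = c k * B (s k) l.
Proof.
rewrite mxE (bigD1 (s k)) //= big1 ?addr0 => [|m /negbTE mk].
  by rewrite mxE eqxx.
by rewrite mxE mk mul0r.
Qed.

Lemma perm_scale_neq0 s c k l : (forall k, c k != 0) ->
  (perm_scale_mx s c k l != 0) = (l == s k).
Proof. by move=> c0; rewrite mxE mulrb; case: (l == s k); rewrite ?c0 ?eqxx. Qed.

Lemma perm_scale_Gedr s c e d : (forall k, c k != 0) ->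
  (forall k, c k ^+ e = 1) -> (\prod_k c k) ^+ (e %/ d) = 1 ->
  Gedr K r e d (perm_scale_mx s c).
Proof.
move=> c0 ce c_prod; split.
- split=> k.
    exists (s k); split=> [|l]; rewrite perm_scale_neq0 //.
    by move/eqP.
  exists (s^-1 k)%g; split=> [|l]; rewrite perm_scale_neq0 // ?permKV //.
  by move/eqP->; rewrite permK.
- by move=> k l; rewrite perm_scale_neq0 // => /eqP->; rewrite mxE eqxx ce.
rewrite -[RHS]c_prod; congr (_ ^+ _).
rewrite -(pair_big_dep xpredT (fun k l => perm_scale_mx s c k l != 0)
            (fun k l => perm_scale_mx s c k l)) /=.
apply: eq_bigr => k _; rewrite (big_pred1 (s k)) => [|l]; last exact: perm_scale_neq0.
by rewrite mxE eqxx.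
Qed.

Lemma fix_perm_scaleP s c x :
  reflect (forall k, c k * x (s k) 0 = x k 0) (x \in fix_mx (perm_scale_mx s c)).
Proof.
by apply: (iffP (fix_mxP _ _)) => E k; move: (E k); rewrite perm_scale_mulE.
Qed.

End Reflections.

Section ReflectionArrangement.
Variables (K : fieldType) (r e d : nat).
Hypotheses (e_gt0 : (0 < e)%N) (d_dvd : (d %| e)%N) (r_gt1 : (1 < r)%N).

(** The diagonal matrix with w at i and 1 elsewhere. *)
Lemma fix_diag_reflection i j (w : K) : w ^+ (e %/ d) = 1 -> w != 1 -> 
  exists g : 'M[K]_r, [/\ Gedr K r e d g, is_reflection g & hyp i j 0 = fix_mx g].
Proof.
move=> w_root w1; pose c k : K := if k == i then w else 1.
have we : w ^+ e = 1 by rewrite -(divnK d_dvd) exprM w_root expr1n.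
have w0 := unity_root_neq0 e_gt0 we.
have fixE : hyp i j 0 = fix_mx (perm_scale_mx 1 c).
  apply/vspaceP => x; rewrite mem_hyp mul0r; apply/eqP/fix_perm_scaleP => [xi k|/(_ i)].
    by rewrite perm1 /c; case: eqP => [->|_]; rewrite ?xi ?mulr0 ?mul1r.
  rewrite perm1 /c eqxx => /eqP; rewrite -subr_eq0 -{2}[x i 0]mul1r -mulrBl mulf_eq0.
  by rewrite subr_eq0 (negbTE w1) => /eqP.
exists (perm_scale_mx 1 c); split=> //.
- apply: perm_scale_Gedr => [k|k|]; rewrite /c.
  + by case: (k == i); rewrite ?w0 ?oner_neq0.
  + by case: (k == i); rewrite ?we ?expr1n.
  by rewrite -big_mkcond big_pred1_eq.
split; last by rewrite -fixE dim_hyp //; right.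
exists e => //.
have powE n : perm_scale_mx 1 c ^+ n = perm_scale_mx 1 (fun k => c k ^+ n).
  elim: n => [|n IHn].
    by apply/matrixP => k l; rewrite !mxE perm1 eq_sym.
  rewrite exprS IHn; apply/matrixP => k l.
  by rewrite [_ * _]/(_ *m _) perm_scale_mulE !mxE !perm1 exprS mulrnAr.
rewrite powE; apply/matrixP => k l; rewrite !mxE perm1 eq_sym /c.
by case: (k == i); rewrite ?we ?expr1n.
Qed.

(** The transposition of i and j, scaled by z and z^-1, so that the product of the
    entries is 1. *)
Lemma fix_transposition_reflection i j (z : K) : i != j -> z ^+ e = 1 ->
  exists g : 'M[K]_r, [/\ Gedr K r e d g, is_reflection g & hyp i j z = fix_mx g].
Proof.
move=> ij ze; pose c k : K := if k == i then z else if k == j then z^-1 else 1.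
have ji : (j == i) = false by rewrite eq_sym (negbTE ij).
have z0 := unity_root_neq0 e_gt0 ze.
have ci : c i = z by rewrite /c eqxx.
have cj : c j = z^-1 by rewrite /c eqxx ji.
have ck k : k != i -> k != j -> c k = 1 by rewrite /c => /negbTE-> /negbTE->.
have c0 k : c k != 0.
  by rewrite /c; case: (k == i) => //; case: (k == j); rewrite ?invr_eq0 ?oner_neq0.
have fixE : hyp i j z = fix_mx (perm_scale_mx (tperm i j) c).
  apply/vspaceP => x; rewrite mem_hyp; apply/eqP/fix_perm_scaleP => [xi k|/(_ i)].
    by case: tpermP => [->|->|/eqP ki /eqP kj]; rewrite ?ci ?cj ?ck ?xi ?mulKf ?mul1r.
  by rewrite tpermL ci.
exists (perm_scale_mx (tperm i j) c); split=> //.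
- apply: perm_scale_Gedr => // [k|].
    rewrite /c; case: (k == i) => //.
    by case: (k == j); rewrite ?exprVn ?ze ?invr1 ?expr1n.
  rewrite (bigD1 i) //= (bigD1 j) ?ji //= big1 => [|k /andP[ki kj]]; last exact: ck.
  by rewrite ci cj mulr1 divff // expr1n.
split; last by rewrite -fixE dim_hyp //; left.
exists 2 => //; apply/matrixP => k l; rewrite expr2 [_ * _]/(_ *m _).
rewrite perm_scale_mulE !mxE tpermK mulrnAr eq_sym; congr (_ *+ _).
by case: tpermP => [->|->|/eqP ki /eqP kj]; rewrite ?ci ?cj ?ck ?divff ?mulVf ?mul1r.
Qed.

(** If row i of g has its nonzero entry at j != i, a fixed vector satisfies
    x_i = g_ij x_j. Otherwise g is diagonal with an entry g_ii != 1, and a fixed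
    vector satisfies x_i = 0. Either way the fixed space is contained in a
    hyperplane of the same dimension. *)
Lemma fix_reflection_hyp (g : 'M[K]_r) : Gedr K r e d g -> is_reflection g ->
  exists i j z, [/\ i != j, zero_or_root e z & fix_mx g = hyp i j z].
Proof.
case=> g_mon g_root _ [_ dim_g].
have fix_sub i j z : i != j -> (forall x, x \in fix_mx g -> x i 0 = z * x j 0) ->
    fix_mx g = hyp i j z.
  move=> ij gz; apply/eqP; rewrite eqEdim -ltnS dim_g dim_hyp ?leqnn ?andbT; last by left.
  by apply/subvP => x xg; rewrite mem_hyp (gz _ xg).
case: (pselect (exists i j, i != j /\ g i j != 0)) => [[i [j [ij gij]]]|diag].
  exists i, j, (g i j); split; rewrite // ?/zero_or_root ?(g_root _ _ gij) ?eqxx ?orbT //.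
  apply: fix_sub => // x /fix_mxP/(_ i) <-.
  exact: monomial_row_mul.
have gd i : g i i != 0.
  have [/(_ i)[k [gik _]] _] := g_mon.
  case: (eqVneq i k) => [{2}->//|ik].
  by case: diag; exists i, k.
have [i gi] : exists i, g i i != 1.
  apply/existsP; rewrite -negb_forall; apply/negP => /forallP g1.
  have : (fullv <= fix_mx g)%VS.
    apply/subvP => x _; apply/fix_mxP => i.
    by rewrite (monomial_row_mul _ g_mon (gd i)) (eqP (g1 i)) mul1r.
  move/dimvS; rewrite dimvf dim_matrix mulr1.
  by rewrite -[X in (X <= _)%N]dim_g ltnn.
have [j ij] := neq_ord_exists i r_gt1.
exists i, j, 0; split; rewrite // /zero_or_root ?eqxx //.
apply: fix_sub => // x /fix_mxP/(_ i); rewrite (monomial_row_mul _ g_mon (gd i)) mul0r.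
move=> /eqP; rewrite -subr_eq0 -{2}[x i 0]mul1r -mulrBl mulf_eq0.
by rewrite subr_eq0 (negbTE gi) => /eqP.
Qed.

Lemma reflection_arrangement_Gedr (U : seq K) (w : K) :
  (forall z, (z \in U) = (z ^+ e == 1)) -> w ^+ (e %/ d) = 1 -> w != 1 ->
  reflection_arrangement (Gedr K r e d) = [set` monomial_arr U r]%classic.
Proof.
move=> U_root w_root w1; apply/seteqP; split=> [_ [g [Gg g_refl ->]]|H] /=.
  by apply/(monomial_arrP U_root _ r_gt1); apply: fix_reflection_hyp.
case/(monomial_arrP U_root _ r_gt1)=> i [j [z [ij]]].
rewrite /zero_or_root => /orP[/eqP->|/eqP ze] ->.
  exact: fix_diag_reflection w_root w1.
exact: fix_transposition_reflection.
Qed.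

End ReflectionArrangement.

Theorem proposition6p1 (R : realType) (e d r : nat)
  (he : (0 < e)%N) (hd : (0 < d)%N) (hde : (d %| e)%N) (hne : e <> d)
  (hr : (1 < r)%N) :
  combinatorially_simplicial (reflection_arrangement (Gedr R[i] r e d)).
Proof.
have [U [U_uniq U_size U_root]] := unity_roots_exist R[i] he.
have q_gt1 : (1 < e %/ d)%N.
  by rewrite ltn_divRL // mul1n ltn_neqAle dvdn_leq // andbT; apply/eqP => /esym.
(* As d != e, there is a diagonal reflection. *)
have [w w_root w1] : exists2 w : R[i], w ^+ (e %/ d) = 1 & w != 1.
  have [W [W_uniq W_size W_root]] := unity_roots_exist R[i] (ltnW q_gt1).
  have /allPn[w wW w1] : ~~ all (pred1 1) W.
    apply/negP => /all_pred1P W1; move: W_uniq; rewrite W1 W_size.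
    by case: (e %/ d)%N q_gt1 => [|[|m]] //= _; rewrite mem_head.
  by exists w => //; apply/eqP; rewrite -W_root.
rewrite (reflection_arrangement_Gedr he hde hr U_root w_root w1).
exact: (monomial_arr_simplicial (K := R[i]) he U_uniq U_size U_root hr).
Qed.
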